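(* Let $n\in\mathbb N_0$, let $q\in\mathbb C$ with $q\ne0$, $|q|\neq1$, and let $\alpha,\beta\in\mathbb C$, such that no denominator below vanishes. Then the continuous $q$-Jacobi polynomials satisfy $$P_n^{(\alpha,\beta)}\left(\tfrac12(q^{\frac{\alpha}{2}+\frac14}+q^{-\frac{\alpha}{2}-\frac14})\big|q\right)=\frac{(q^{\alpha+1};q)_n}{(q;q)_n},$$ $$P_n^{(\alpha,\beta)}\left(\tfrac12(q^{\frac{\alpha}{2}+\frac34}+q^{-\frac{\alpha}{2}-\frac34})\big|q\right)=q^{-\frac n2}\frac{(q^{\alpha+1},-q^{\frac12(\alpha+\beta+3)};q)_n}{(q,-q^{\frac12(\alpha+\beta+1)};q)_n},$$ $$P_n^{(\alpha,\beta)}\left(-\tfrac12(q^{\frac{\beta}{2}+\frac14}+q^{-\frac{\beta}{2}-\frac14})\big|q\right)=\left(-q^{\frac{\alpha-\beta}{2}}\right)^n\frac{(q^{\beta+1};q)_n}{(q;q)_n},$$ $$P_n^{(\alpha,\beta)}\left(-\tfrac12(q^{\frac{\beta}{2}+\frac34}+q^{-\frac{\beta}{2}-\frac34})\big|q\right)=\left(-q^{\frac{\alpha-\beta-1}{2}}\right)^n\frac{(q^{\beta+1},-q^{\frac12(\alpha+\beta+3)};q)_n}{(q,-q^{\frac12(\alpha+\beta+1)};q)_n}.$$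
   Context: Complex powers of $q$: fix a logarithm $\log q$ and set $q^s:=\exp(s\log q)$. Notation: $(a;q)_n:=\prod_{k=0}^{n-1}(1-aq^k)$, and $(a_1,\dots,a_r;q)_n:=\prod_i (a_i;q)_n$. Askey--Wilson polynomials: for $x=\frac12(z+z^{-1})$, $z\in\mathbb C\setminus\{0\}$, $$p_n(x;a,b,c,d|q):=a^{-n}(ab,ac,ad;q)_n\sum_{k=0}^n\frac{(q^{-n},q^{n-1}abcd,az,az^{-1};q)_k}{(q,ab,ac,ad;q)_k}q^k,$$ where $(ab;q)_n/(ab;q)_k$ is read as $(abq^k;q)_{n-k}$ (likewise for $ac$, $ad$), so that $p_n$ is always defined. Continuous $q$-Jacobi polynomials: $$P_n^{(\alpha,\beta)}(x|q):=\frac{q^{(\frac{\alpha}{2}+\frac14)n}}{(q,-q^{\frac{\alpha+\beta+1}{2}},-q^{\frac{\alpha+\beta+2}{2}};q)_n}\,p_n\left(x;q^{\frac{\alpha}{2}+\frac14},q^{\frac{\alpha}{2}+\frac34},-q^{\frac{\beta}{2}+\frac14},-q^{\frac{\beta}{2}+\frac34}\big|q\right).$$ *)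

(* Defs.v *)
From HB Require Import structures.
From mathcomp Require Import all_boot all_order all_algebra.
From mathcomp Require Import complex.
From mathcomp Require Import reals sequences exp trigo.
From mathcomp Require Import ring.

Set Implicit Arguments.
Unset Strict Implicit.
Unset Printing Implicit Defensive.

Import Order.TTheory GRing.Theory Num.Theory.
Local Open Scope ring_scope.

Section AskeyWilson.
Variable C : numClosedFieldType.
Implicit Types (a b c d q x z : C) (n k : nat).

Definition qpoch a q n : C := \prod_(k < n) (1 - a * q ^+ k).

(* (a_1, ..., a_r; q)_n *)
Definition qpochs (s : seq C) q n : C := \prod_(a <- s) qpoch a q n.

(* The Askey-Wilson polynomial in terms of z.  The quotients
   (ab; q)_n / (ab; q)_k are read as (ab q^k; q)_(n - k), and likewise for
   ac and ad, so that the value is meaningful also when (ab; q)_k = 0.  The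
   exponent n - 1 is an integer, equal to -1 for n = 0. *)
Definition askey_wilson_z n a b c d q z : C :=
  a ^- n *
  \sum_(k < n.+1)
    qpochs [:: a * b * q ^+ k; a * c * q ^+ k; a * d * q ^+ k] q (n - k) *
    (qpochs [:: q ^- n; q ^ (n%:Z - 1) * a * b * c * d; a * z; a * z^-1] q k
       / qpoch q q k) * q ^+ k.

(* Every x is (z + z^-1) / 2 for z := x + sqrt (x^2 - 1); by askey_wilsonE
   below any other such z gives the same value. *)
Definition askey_wilson n a b c d q x : C :=
  askey_wilson_z n a b c d q (x + sqrtC (x ^+ 2 - 1)).

Lemma askey_wilson_zV n a b c d q z :
  askey_wilson_z n a b c d q z^-1 = askey_wilson_z n a b c d q z.
Proof.
congr (_ * _); apply: eq_bigr => k _; congr (_ * (_ / _) * _).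
by rewrite /qpochs !big_cons !big_nil invrK (mulrCA (qpoch (a * z^-1) q k)).
Qed.

Lemma askey_wilsonE n a b c d q z : z != 0 ->
  askey_wilson n a b c d q (2^-1 * (z + z^-1)) = askey_wilson_z n a b c d q z.
Proof.
move=> z0; rewrite /askey_wilson.
set x := 2^-1 * _; set s := sqrtC _.
have n2 : (2 : C) != 0 by rewrite pnatr_eq0.
have: s ^+ 2 == (2^-1 * (z - z^-1)) ^+ 2.
  by rewrite sqrtCK; apply/eqP; rewrite /x; field; rewrite z0.
rewrite eqf_sqr => /orP[] /eqP ->.
  by congr askey_wilson_z; rewrite /x; field; rewrite z0.
rewrite -[RHS]askey_wilson_zV.
by congr askey_wilson_z; rewrite /x; field; rewrite z0.
Qed.

End AskeyWilson.

Section ContinuousQJacobi.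
Variable R : realType.
Local Notation C := (complex R).

Definition cexp (s : C) : C :=
  Complex (expR (complex.Re s) * cos (complex.Im s))
          (expR (complex.Re s) * sin (complex.Im s)).

(* q^s = exp (s log q), for a logarithm lq of q: cexp lq = q. *)
Definition qpow (lq s : C) : C := cexp (s * lq).

Definition cqjacobi (n : nat) (alpha beta q lq x : C) : C :=
  qpow lq ((alpha / 2 + 1 / 4) * n%:R)
  / qpochs [:: q; - qpow lq ((alpha + beta + 1) / 2);
                  - qpow lq ((alpha + beta + 2) / 2)] q n
  * askey_wilson n (qpow lq (alpha / 2 + 1 / 4)) (qpow lq (alpha / 2 + 3 / 4))
      (- qpow lq (beta / 2 + 1 / 4)) (- qpow lq (beta / 2 + 3 / 4)) q x.

End ContinuousQJacobi.

(* Main.v *)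
(* Each of the four points is (z + 1/z) / 2 with z one of the parameters
   a, b, c, d of the Askey-Wilson polynomial.  At z = a only the term k = 0
   survives.  At z = b the factor (ab; q)_k cancels and the series becomes a
   balanced terminating 3phi2, summed by the q-Saalschuetz formula, which
   follows from a Wilf-Zeilberger certificate.  The cases z = c, d reduce to
   z = b by the evident symmetry in b, c, d. *)
Require Import Defs.
From HB Require Import structures.
From mathcomp Require Import all_boot all_order all_algebra.
From mathcomp Require Import complex.
From mathcomp Require Import reals exp trigo.
From mathcomp Require Import ring.

Set Implicit Arguments.
Unset Strict Implicit.
Unset Printing Implicit Defensive.

Import Order.TTheory GRing.Theory Num.Theory.
Local Open Scope ring_scope.

Section QSaalschutz.
Variable C : numClosedFieldType.
Implicit Types (a b c d q u v x z : C) (n k m : nat).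

Lemma qpoch0 a q : qpoch a q 0 = 1.
Proof. by rewrite /qpoch big_ord0. Qed.

Lemma qpochSr a q n : qpoch a q n.+1 = qpoch a q n * (1 - a * q ^+ n).
Proof. by rewrite /qpoch big_ord_recr. Qed.

Lemma qpochSl a q n : qpoch a q n.+1 = (1 - a) * qpoch (a * q) q n.
Proof.
rewrite /qpoch big_ord_recl expr0 mulr1; congr (_ * _).
by apply: eq_bigr => i _; rewrite /= exprS mulrA.
Qed.

Lemma qpochD a q m n : qpoch a q (m + n) = qpoch a q m * qpoch (a * q ^+ m) q n.
Proof.
elim: n => [|n IH]; first by rewrite addn0 qpoch0 mulr1.
by rewrite addnS !qpochSr IH exprD !mulrA.
Qed.

Lemma qpoch1 q n : qpoch 1 q n.+1 = 0.
Proof. by rewrite qpochSl subrr mul0r. Qed.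

Lemma qpochs3 a b c q n :
  qpochs [:: a; b; c] q n = qpoch a q n * qpoch b q n * qpoch c q n.
Proof. by rewrite /qpochs !big_cons big_nil mulr1 !mulrA. Qed.

Lemma qpochs2 a b q n : qpochs [:: a; b] q n = qpoch a q n * qpoch b q n.
Proof. by rewrite /qpochs !big_cons big_nil mulr1. Qed.

(* Clearing the denominators (u; q)_k, (v; q)_k of the q-Saalschuetz series keeps
   the sum meaningful when they vanish. *)
Definition saalschutz_term u v x q n k : C :=
  qpoch (u * q ^+ k) q (n - k) * qpoch (v * q ^+ k) q (n - k)
  * (qpoch (q ^- n) q k * qpoch (q ^+ n / q * (u * v / x)) q k * qpoch x q k
     / qpoch q q k) * q ^+ k.

Lemma qpoch_self_neq0 q n : (forall k, q ^+ k.+1 != 1) -> qpoch q q n != 0.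
Proof.
move=> hq; apply/prodf_neq0 => i _.
by rewrite -exprS subr_eq0 eq_sym hq.
Qed.

(* The right-hand side is the Wilf-Zeilberger mate of [saalschutz_term]; the
   factor in front of the second term is the quotient of the closed forms of
   the sum for n + 1 and for n. *)
Lemma saalschutz_telescope u v x q n m :
  q != 0 -> (forall k, q ^+ k.+1 != 1) -> x != 0 -> (m <= n)%N ->
  \sum_(k < m.+1) (saalschutz_term u v x q n.+1 k
     - (x - u * q ^+ n) * (1 - v * q ^+ n / x) * saalschutz_term u v x q n k)
  = (1 - u * v / x * q ^+ n * q ^+ n)
    * (qpoch (u * q ^+ m) q (n - m) * qpoch (v * q ^+ m) q (n - m)
       * qpoch (q ^- n) q m * qpoch (q ^+ n * (u * v / x)) q m
       * qpoch x q m.+1 / qpoch q q m).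
Proof.
move=> q0 hq x0; elim: m => [|m IH] lemn.
  rewrite big_ord1 /saalschutz_term !subn0 !expr0 !qpoch0 !qpochSr !qpoch0.
  by field.
rewrite big_ord_recr IH /=; last exact: ltnW.
(* With n = m + 1 + j the lengths n - m and n - (m + 1) become j + 1 and j, so the symbols in [u]
   and [v] reduce to common ones of length j. *)
rewrite -(subnKC lemn); set j := (n - m.+1)%N.
rewrite /saalschutz_term subSS.
have -> : (m.+1 + j - m = j.+1)%N by rewrite addSnnS addKn.
rewrite addKn.
have eqn w : qpoch (w * q ^+ m) q j.+1 = (1 - w * q ^+ m) * qpoch (w * q ^+ m.+1) q j.
  by rewrite qpochSl exprSr mulrA.
rewrite !eqn (qpochSr (u * _)) (qpochSr (v * _)).
rewrite (qpochSr x q m.+1) (qpochSr q q m).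
set N := (m.+1 + j)%N.
(* Peeling off a first or a last factor brings the terms for [N] and [N.+1] to the same symbols of
   length m. *)
have hN1 : q ^- N.+1 * q = q ^- N by rewrite exprS invfM mulrAC mulVf ?mul1r.
have hN2 : q ^+ N / q * (u * v / x) * q = q ^+ N * (u * v / x) by field; rewrite x0 q0.
have hN3 : q ^+ N.+1 / q = q ^+ N by rewrite exprSr mulfK.
rewrite (qpochSl (q ^- N.+1)) hN1 (qpochSl (q ^+ N / q * _)) hN2 hN3.
rewrite (qpochSr (q ^- N)) (qpochSr (q ^+ N * _)).
have P0 := qpoch_self_neq0 m hq.
have K1 : 1 - q * q ^+ m != 0 by rewrite -exprS subr_eq0 eq_sym hq.
have Q0 : q ^+ N != 0 by rewrite expf_neq0.
(* Once q^N is written through q, q^m and q^j, only a rational identity remains. *)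
have eqN : q ^+ N = q * q ^+ m * q ^+ j by rewrite /N exprD exprS.
have qm0 : q ^+ m != 0 by rewrite expf_neq0.
have qj0 : q ^+ j != 0 by rewrite expf_neq0.
clearbody N; rewrite !exprS eqN.
field.
by rewrite x0 q0 qm0 qj0 K1 P0.
Qed.

(** Induction on [n]. The telescoped identity at m = n covers all terms of the sum for n + 1 but the
    last, and that last term is minus the telescoped remainder. What is left is the sum for n times
    x (1 - u q^n / x) (1 - v q^n / x). *)
Lemma q_saalschutz u v x q n :
  q != 0 -> (forall k, q ^+ k.+1 != 1) -> x != 0 ->
  \sum_(k < n.+1) saalschutz_term u v x q n k
  = x ^+ n * qpoch (u / x) q n * qpoch (v / x) q n.
Proof.
move=> q0 hq x0; elim: n => [|n IH].
  by rewrite big_ord1 /saalschutz_term subn0 !expr0 !qpoch0 divr1 !mulr1.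
have := saalschutz_telescope u v q0 hq x0 (leqnn n).
rewrite sumrB -mulr_sumr IH => /eqP; rewrite subr_eq => /eqP tel.
rewrite big_ord_recr tel /= /saalschutz_term !subnn !qpoch0.
have hN1 : q ^- n.+1 * q = q ^- n by rewrite exprS invfM mulrAC mulVf ?mul1r.
have hN2 : q ^+ n.+1 / q = q ^+ n by rewrite exprSr mulfK.
rewrite (qpochSl (q ^- n.+1)) hN1 hN2 (qpochSr (q ^+ n * _)) (qpochSr q).
rewrite (qpochSr (u / x)) (qpochSr (v / x)).
have P0 := qpoch_self_neq0 n hq.
have K1 : 1 - q * q ^+ n != 0 by rewrite -exprS subr_eq0 eq_sym hq.
have qn0 : q ^+ n != 0 by rewrite expf_neq0.
rewrite !exprS; field.
by rewrite x0 q0 qn0 K1 P0.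
Qed.

(** The factor (a/z; q)_k becomes (1; q)_k, which vanishes for k > 0. *)
Lemma askey_wilson_z_a n a b c d q : a != 0 ->
  askey_wilson_z n a b c d q a = a ^- n * qpochs [:: a * b; a * c; a * d] q n.
Proof.
move=> a0; rewrite /askey_wilson_z big_ord_recl big1 => [|i _].
  rewrite /= subn0 expr0 /qpochs !big_cons big_nil !qpoch0.
  by rewrite !big_nil divr1 !mulr1 addr0.
by rewrite lift0 divff // /qpochs !big_cons qpoch1 big_nil !(mul0r, mulr0).
Qed.

(** Here az = ab, so (az; q)_k and (ab q^k; q)_(n-k) join to (ab; q)_n, free of k. The rest is the
    q-Saalschuetz sum with u = ac, v = ad, x = a/b, whence u/x = bc, v/x = bd and uv/x = abcd. *)
Lemma askey_wilson_z_b n a b c d q :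
  q != 0 -> (forall k, q ^+ k.+1 != 1) -> a != 0 -> b != 0 ->
  askey_wilson_z n a b c d q b = b ^- n * qpochs [:: a * b; b * c; b * d] q n.
Proof.
move=> q0 hq a0 b0; rewrite /askey_wilson_z.
rewrite (eq_bigr (fun k : 'I_n.+1 =>
    qpoch (a * b) q n * saalschutz_term (a * c) (a * d) (a / b) q n k)).
  have x0 : a / b != 0 by rewrite mulf_neq0 ?invr_eq0.
  rewrite -mulr_sumr q_saalschutz // qpochs3.
  have -> : a * c / (a / b) = b * c by field; rewrite a0 b0.
  have -> : a * d / (a / b) = b * d by field; rewrite a0 b0.
  rewrite expr_div_n; field.
  by rewrite !expf_neq0.
move=> k _; have lekn : (k <= n)%N by rewrite -ltnS.
have -> : qpoch (a * b) q n = qpoch (a * b) q k * qpoch (a * b * q ^+ k) q (n - k).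
  by rewrite -qpochD subnKC.
rewrite /saalschutz_term /qpochs !big_cons !big_nil.
(* The integer power q^(n-1) becomes q^n / q, which is valid for n = 0 too. *)
rewrite expfzDr // -exprnP exprN1.
have -> : q ^+ n / q * (a * c * (a * d) / (a / b)) = q ^+ n / q * a * b * c * d.
  by field; rewrite a0 b0 q0.
ring.
Qed.

Lemma askey_wilson_z_swap_bc n a b c d q z :
  askey_wilson_z n a b c d q z = askey_wilson_z n a c b d q z.
Proof.
congr (_ * _); apply: eq_bigr => k _.
rewrite !qpochs3 (mulrAC _ b c); congr (_ * _ * _).
by rewrite (mulrC (qpoch (a * b * _) _ _)).
Qed.

Lemma askey_wilson_z_swap_cd n a b c d q z :
  askey_wilson_z n a b c d q z = askey_wilson_z n a b d c q z.
Proof.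
congr (_ * _); apply: eq_bigr => k _.
by rewrite !qpochs3 (mulrAC _ c d) (mulrAC (qpoch (a * b * _) _ _)).
Qed.

End QSaalschutz.

Section ComplexPowers.
Variable R : realType.
Local Notation C := (complex R).
Implicit Types (lq s t : C).

Lemma cexpD s t : cexp (s + t) = cexp s * cexp t.
Proof.
case: s t => [s1 s2] [t1 t2]; rewrite /cexp /= expRD cosD sinD.
by apply/eqP; rewrite eq_complex /=; apply/andP; split; apply/eqP; ring.
Qed.

Lemma cexp0 : cexp (0 : C) = 1.
Proof. by rewrite /cexp /= expR0 cos0 sin0 mulr1 mulr0. Qed.

Lemma qpowD lq s t : qpow lq (s + t) = qpow lq s * qpow lq t.
Proof. by rewrite /qpow mulrDl cexpD. Qed.

Lemma qpow0 lq : qpow lq 0 = 1.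
Proof. by rewrite /qpow mul0r cexp0. Qed.

Lemma qpow_neq0 lq s : qpow lq s != 0.
Proof.
apply/eqP => h; have := qpow0 lq; rewrite -(subrr s) qpowD h mul0r => /eqP.
by rewrite eq_sym oner_eq0.
Qed.

Lemma qpowN lq s : qpow lq (- s) = (qpow lq s)^-1.
Proof.
by apply: (mulfI (qpow_neq0 lq s)); rewrite -qpowD subrr qpow0 divff ?qpow_neq0.
Qed.

Lemma qpowMn lq s n : qpow lq (s * n%:R) = qpow lq s ^+ n.
Proof.
elim: n => [|n IH]; first by rewrite mulr0 qpow0.
by rewrite -addn1 natrD mulrDr mulr1 qpowD IH exprD.
Qed.

End ComplexPowers.

Theorem corollary2p2 (R : realType) (n : nat) (q lq alpha beta : complex R)
    (hq0 : q != 0) (hq1 : `|q| != 1) (hlq : cexp lq = q)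
    (hden : qpochs [:: q; - qpow lq ((alpha + beta + 1) / 2);
                          - qpow lq ((alpha + beta + 2) / 2)] q n != 0) :
  [/\ cqjacobi n alpha beta q lq
        (1 / 2 * (qpow lq (alpha / 2 + 1 / 4) + qpow lq (- (alpha / 2) - 1 / 4)))
      = qpoch (qpow lq (alpha + 1)) q n / qpoch q q n,
      cqjacobi n alpha beta q lq
        (1 / 2 * (qpow lq (alpha / 2 + 3 / 4) + qpow lq (- (alpha / 2) - 3 / 4)))
      = qpow lq (- (n%:R / 2)) *
        (qpochs [:: qpow lq (alpha + 1);
                    - qpow lq (1 / 2 * (alpha + beta + 3))] q n
         / qpochs [:: q; - qpow lq (1 / 2 * (alpha + beta + 1))] q n),
      cqjacobi n alpha beta q lq
        (- (1 / 2 * (qpow lq (beta / 2 + 1 / 4) + qpow lq (- (beta / 2) - 1 / 4))))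
      = (- qpow lq ((alpha - beta) / 2)) ^+ n *
        (qpoch (qpow lq (beta + 1)) q n / qpoch q q n)
    & cqjacobi n alpha beta q lq
        (- (1 / 2 * (qpow lq (beta / 2 + 3 / 4) + qpow lq (- (beta / 2) - 3 / 4))))
      = (- qpow lq ((alpha - beta - 1) / 2)) ^+ n *
        (qpochs [:: qpow lq (beta + 1);
                    - qpow lq (1 / 2 * (alpha + beta + 3))] q n
         / qpochs [:: q; - qpow lq (1 / 2 * (alpha + beta + 1))] q n)].
Proof.
(* Roots of unity have modulus 1. *)
have hq k : q ^+ k.+1 != 1.
  apply: contra hq1 => /eqP h.
  by rewrite -(pexpr_eq1 (ltn0Sn k) (normr_ge0 q)) -normrX h normr1.
(* The Askey-Wilson parameters are [a], [b], [- c], [- d]; every power of q in the claim is a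
   monomial in [a], [b], [c], [d]. *)
set a := qpow lq (alpha / 2 + 1 / 4); set b := qpow lq (alpha / 2 + 3 / 4).
set c := qpow lq (beta / 2 + 1 / 4); set d := qpow lq (beta / 2 + 3 / 4).
have a0 : a != 0 := qpow_neq0 _ _.
have b0 : b != 0 := qpow_neq0 _ _.
have c0 : c != 0 := qpow_neq0 _ _.
have d0 : d != 0 := qpow_neq0 _ _.
have Ec0 : - c != 0 by rewrite oppr_eq0.
have Ed0 : - d != 0 by rewrite oppr_eq0.
have inv (w r : complex R) : qpow lq (- w - r) = (qpow lq (w + r))^-1.
  by rewrite -opprD qpowN.
have eab : qpow lq (alpha + 1) = a * b by rewrite -qpowD; congr qpow; field.
have ecd : qpow lq (beta + 1) = c * d by rewrite -qpowD; congr qpow; field.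
have eac : qpow lq ((alpha + beta + 1) / 2) = a * c.
  by rewrite -qpowD; congr qpow; field.
have ead : qpow lq ((alpha + beta + 2) / 2) = a * d.
  by rewrite -qpowD; congr qpow; field.
(* This coincidence cancels (-bc; q)_n against (-ad; q)_n in the normalisation. *)
have ebc : b * c = a * d by rewrite -!qpowD; congr qpow; field.
have ebd : qpow lq (1 / 2 * (alpha + beta + 3)) = b * d.
  by rewrite -qpowD; congr qpow; field.
have eac' : qpow lq (1 / 2 * (alpha + beta + 1)) = a * c.
  by rewrite -qpowD; congr qpow; field.
have e_ab : qpow lq (- (n%:R / 2)) = a ^+ n / b ^+ n.
  by rewrite -expr_div_n -qpowN -qpowD -qpowMn; congr qpow; field.
have e_ac : qpow lq ((alpha - beta) / 2) = a / c.
  by rewrite -qpowN -qpowD; congr qpow; field.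
have e_ad : qpow lq ((alpha - beta - 1) / 2) = a / d.
  by rewrite -qpowN -qpowD; congr qpow; field.
move: hden; rewrite /cqjacobi !inv qpowMn -/a -/b -/c -/d.
rewrite eab ecd eac ead ebd eac' e_ab e_ac e_ad !qpochs3 !qpochs2 div1r.
(* The sign moves into z, so that the last two points have z = -c and z = -d. *)
rewrite -!(mulrN (2^-1) (_ + _)) !opprD -!invrN !askey_wilsonE //.
rewrite (askey_wilson_z_a _ _ _ _ _ a0) (askey_wilson_z_b _ _ _ hq0 hq a0 b0).
(* The swaps bring [- c], then [- d], into the second parameter slot. *)
rewrite (askey_wilson_z_swap_bc _ _ b) (askey_wilson_z_b _ _ _ hq0 hq a0 Ec0).
rewrite (askey_wilson_z_swap_cd _ _ b) (askey_wilson_z_swap_bc _ _ b).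
rewrite (askey_wilson_z_b _ _ _ hq0 hq a0 Ed0) !qpochs3.
rewrite -[- (a / c)]mulrN -invrN -[- (a / d)]mulrN -invrN !expr_div_n.
rewrite !mulrN !mulNr !opprK (mulrC c b) (mulrC d b) (mulrC d c) ebc !mulf_eq0.
rewrite !negb_or -andbA => /and3P[].
move: (expf_neq0 n a0) (expf_neq0 n b0) (expf_neq0 n Ec0) (expf_neq0 n Ed0).
move: (a ^+ n) (b ^+ n) ((- c) ^+ n) ((- d) ^+ n) => an bn cn dn An0 Bn0 Cn0 Dn0.
(* Six distinct symbols remain; as free variables they leave four rational identities. *)
move: (qpoch _ _ _) (qpoch _ _ _) (qpoch _ _ _) (qpoch _ _ _).
move: (qpoch _ _ _) (qpoch _ _ _) => p1 p2 p3 p4 p5 p6 Q0 AC0 AD0.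
by split; field; rewrite ?An0 ?Bn0 ?Cn0 ?Dn0 ?Q0 ?AC0 ?AD0.
Qed.
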